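(* For every integer $q\ge 1$ we have $$\gamma^{ID}(K_q^3)\ge q^2-\frac{3}{2}q.$$
   Context: $K_q^3=K_q\square K_q\square K_q$ is the graph with vertex set $\{(x,y,z)\in\mathbb{Z}^3\mid 1\le x,y,z\le q\}$ in which two distinct vertices are adjacent iff they differ in exactly one coordinate. $N[v]$ is the closed neighbourhood of $v$; a code is a nonempty set $C$ of vertices; $I(u)=N[u]\cap C$. A code $C$ is identifying in a graph if $I(u)\ne\emptyset$ for every vertex $u$ and $I(u)\neq I(v)$ for all distinct vertices $u,v$. $\gamma^{ID}(G)$ is the minimum cardinality of an identifying code in the finite graph $G$. *)

(* Defs.v *)
From mathcomp Require Import all_boot.

Set Implicit Arguments.
Unset Strict Implicit.
Unset Printing Implicit Defensive.

(* A finite graph is given by its adjacency relation [e] on a finite type [T].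
   Loops, if any, do not affect closed neighbourhoods. *)
Section IdentifyingCodes.

Variables (T : finType) (e : rel T).
Implicit Types (u v : T) (C : {set T}).

Definition closed_nbhd u : {set T} := [set v | (v == u) || e u v].

Definition Iset C u : {set T} := closed_nbhd u :&: C.

Definition identifying_code C : bool :=
  [&& C != set0,
      [forall u, Iset C u != set0] &
      [forall u, forall v, (u != v) ==> (Iset C u != Iset C v)]].

Lemma identifying_codeP C :
  reflect [/\ C <> set0, forall u, Iset C u <> set0 &
              forall u v, u <> v -> Iset C u <> Iset C v]
          (identifying_code C).
Proof.
apply: (iffP and3P) => [[/eqP C0 /forallP I0 /forallP sep]|[C0 I0 sep]].
  split=> // [u|u v /eqP uv]; first exact/eqP.
  by apply/eqP; exact: (implyP (forallP (sep u) v)).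
split; first exact/eqP.
  by apply/forallP => u; apply/eqP.
apply/forallP => u; apply/forallP => v; apply/implyP => /eqP uv.
by apply/eqP; exact: sep.
Qed.

Lemma identifying_code_superset C C' :
  C \subset C' -> identifying_code C -> identifying_code C'.
Proof.
move=> sCC' /identifying_codeP[C0 I0 sep].
have IC u : Iset C u = Iset C' u :&: C.
  by rewrite /Iset -setIA (setIidPr sCC').
apply/identifying_codeP; split=> [C'0|u I'0|u v uv I'].
- by apply: C0; apply/eqP; rewrite -subset0 -C'0.
- by apply: (I0 u); rewrite IC I'0 set0I.
- by apply: (sep u v uv); rewrite !IC I'.
Qed.

(* The minimum cardinality of an identifying code. The starting point [setT] is
   harmless: by [identifying_code_superset] it is an identifying code as soon
   as there is one. *)
Definition gammaID : nat :=
  #|[arg min_(C < [set: T] | identifying_code C) #|C|]|.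

Lemma gammaIDP : (exists C, identifying_code C) ->
  (exists2 C, identifying_code C & #|C| = gammaID) /\
  (forall C, identifying_code C -> gammaID <= #|C|).
Proof.
move=> [C0 idC0]; rewrite /gammaID.
case: arg_minnP => [|C idC minC]; last by split=> //; exists C.
exact: identifying_code_superset (subsetT C0) idC0.
Qed.

End IdentifyingCodes.

(* Coordinates range over {0, ..., q - 1} instead of {1, ..., q}. *)
Definition Kq3_vertex (q : nat) : finType := ('I_q * 'I_q * 'I_q)%type.

Definition Kq3 (q : nat) : rel (Kq3_vertex q) := fun u v =>
  (u.1.1 != v.1.1) + (u.1.2 != v.1.2) + (u.2 != v.2) == 1.

Lemma Kq3_identifiable (q : nat) :
  0 < q -> exists C, identifying_code (@Kq3 q) C.
Proof.
move=> q0; exists setT; apply/identifying_codeP.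
have IT u : Iset (@Kq3 q) setT u = closed_nbhd (@Kq3 q) u by rewrite /Iset setIT.
split=> [/setP/(_ (Ordinal q0, Ordinal q0, Ordinal q0))|u|].
- by rewrite !inE.
- by rewrite IT => /setP/(_ u); rewrite !inE eqxx.
move=> [[x y] z] [[x' y'] z'] uv; rewrite !IT => /setP N.
have other (a b c : 'I_q) : a != b -> exists d : 'I_q, d != c.
  by move=> ab; case: (eqVneq a c) ab => [->|ac _]; [exists b; rewrite eq_sym|exists a].
have := N (x, y, z); rewrite !inE /Kq3 /= eqxx /= => /esym.
rewrite !xpair_eqE ![x' == x]eq_sym ![y' == y]eq_sym ![z' == z]eq_sym.
case: (eqVneq x x') => [ex|nx]; case: (eqVneq y y') => [ey|ny];
  case: (eqVneq z z') => [ez|nz] //= _; subst => //.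
- have [d dx] := other _ _ x' nz.
  have := N (d, y', z); rewrite !inE /Kq3 /= !xpair_eqE !eqxx /=.
  by rewrite ![x' == d]eq_sym ![z' == z]eq_sym (negPf dx) (negPf nz).
- have [d dx] := other _ _ x' ny.
  have := N (d, y, z'); rewrite !inE /Kq3 /= !xpair_eqE !eqxx /=.
  by rewrite ![x' == d]eq_sym ![y' == y]eq_sym (negPf dx) (negPf ny).
- have [d dy] := other _ _ y' nx.
  have := N (x, d, z'); rewrite !inE /Kq3 /= !xpair_eqE !eqxx /=.
  by rewrite ![y' == d]eq_sym ![x' == x]eq_sym (negPf dy) (negPf nx).
Qed.

(* Main.v *)
Require Import Defs.
From mathcomp Require Import all_boot all_order all_algebra.
From mathcomp Require Import zify lra.

Import Order.TTheory GRing.Theory Num.Theory.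
Local Open Scope ring_scope.

(** The neighbourhood [N[u]] is the union of the three axis-parallel lines
    through [u], so [Iset u] is the union of three sets [pipe i u], the
    codewords on the line in direction [i].  If two of them are empty, [Iset u]
    is the third one; call such a [u] exposed, and call a line shared if it has
    at least two codewords.  The proof counts exposed vertices twice.

    From below, layer by layer.  Fix a layer orthogonal to direction [k], with
    [l] codewords, of which [n] are crossed: they share both of their lines
    inside the layer with other codewords.  If [d] and [d'] are the numbers of
    empty lines of the layer in its two directions, then [d * d'] of its
    vertices are exposed.  A direction has at least [q - l] empty lines, and
    sharing leaves more of them empty: a line with [m >= 2] codewords wastes
    [m - 1 >= m / 2] of them, so [q - l + n / 2 <= minn d d'].  As
    [6 m <= 9 + m ^ 2] for every [m], this gives
    [6 (q - l) + 3 n <= 9 + d * d'] ([missed_layer_bound]).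

    From above, globally.  Separation makes [Iset] injective, so few vertices
    can have a single nonempty pipe.  For an exposed vertex, [Iset] is either a
    pipe with several codewords, or a singleton [[set c]], and then [c] must
    have other codewords on its lines, since otherwise [Iset c] would be the
    same singleton.  A codeword with just one shared line also has a pipe as its
    [Iset], so it competes with the exposed vertices for the shared pipes
    ([card_all_exposed_le]).  Since every shared pipe has at least two
    codewords, counting incidences bounds the number of exposed vertices by
    [\sum_c (mdeg c + 1)], over the codewords [c] with [mdeg c >= 2] shared lines.
    Now [mdeg c + 1 <= 3 * 'C(mdeg c, 2)], so there are at most three times as many
    exposed vertices as crossed pairs (layer, codeword)
    ([all_exposed_le_crossed]).

    Summing the layer inequality over the [3 q] layers, the crossed terms
    cancel, and [18 q ^ 2 <= 27 q + 18 #|C|] remains. *)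

(** * Two inequalities on natural numbers and finite sets *)

Section Counting.
Local Open Scope nat_scope.

(** A fibre with [m >= 2] elements contributes [m + 2 <= 2 m] to the left-hand
    side, a singleton fibre contributes [2]. *)
Lemma card_repeated_add_imset (T S : finType) (f : T -> S) (A : {set T}) :
  #|[set x in A | 1 < #|[set y in A | f y == f x]|]| + 2 * #|f @: A|
    <= 2 * #|A|.
Proof.
have fibre b : \sum_(x in A | f x == b) 1 = #|[set y in A | f y == b]|.
  by rewrite -sum1_card; apply: eq_bigl => x; rewrite inE.
rewrite -!sum1_card !big_distrr /=.
rewrite [X in _ <= X](partition_big f [in f @: A]) /=; last first.
  by move=> x; apply: imset_f.
rewrite [X in X + _](partition_big f [in f @: A]) /=; last first.
  by move=> x; rewrite inE => /andP[xA _]; apply: imset_f.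
rewrite -big_split /=; apply: leq_sum => b /imsetP[x0 x0A ->].
rewrite -big_distrr /= fibre.
set F := [set y in A | f y == f x0].
have -> : \sum_(x in [set x in A | 1 < #|[set y in A | f y == f x]|]
              | f x == f x0) 1 = if 1 < #|F| then #|F| else 0.
  case: ifP => fib.
    rewrite /F -fibre; apply: eq_bigl => x; rewrite inE.
    by case: (f x =P f x0) => [->|]; rewrite ?fib ?andbT ?andbF.
  apply: big1 => x; rewrite inE => /andP[/andP[_ +] /eqP fx].
  by rewrite fx fib.
have : 0 < #|F|.
  by apply/card_gt0P; exists x0; rewrite inE x0A /=.
case: ifP; lia.
Qed.

(** The instance [0 <= (m - 3) ^ 2] of the inequality between arithmetic and
    geometric means, at the smaller factor; the value [3] is the number of empty
    lines per layer at which the final bound would be attained. *)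
Lemma six_minn_le d e : 6 * minn d e <= 9 + d * e.
Proof.
have sqr m : 6 * m <= 9 + m * m by have [?|?] := leqP m 3; nia.
apply: leq_trans (sqr _) _; rewrite leq_add2l.
by rewrite leq_mul ?geq_minl ?geq_minr.
Qed.

End Counting.

(** * Lines of the cube *)

Section Code.
Local Open Scope nat_scope.

Variable q : nat.
Notation V := (Kq3_vertex q).
Notation dir := 'I_3.

(** Given a direction [k], the other two are named [ordS k] and [ord_pred k], so
    that one statement in [k] covers the three positions of a layer. *)
Lemma neq_dir (i k : dir) : (i != k) = (i == ordS k) || (i == ord_pred k).
Proof. by case: i k => [[|[|[|]]] // ?] [[|[|[|]]] // ?]. Qed.

Lemma ordS_neq (k : dir) : ordS k != k.
Proof. by rewrite neq_dir eqxx. Qed.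

Lemma ord_pred_neq (k : dir) : ord_pred k != k.
Proof. by rewrite neq_dir eqxx orbT. Qed.

Lemma ord_pred_neqS (k : dir) : ord_pred k != ordS k.
Proof. by case: k => [[|[|[|]]]]. Qed.

Lemma ordSS (k : dir) : ordS (ordS k) = ord_pred k.
Proof. by apply/eqP; case: k => [[|[|[|]]]]. Qed.

Lemma ord_predpred (k : dir) : ord_pred (ord_pred k) = ordS k.
Proof. by apply/eqP; case: k => [[|[|[|]]]]. Qed.

Lemma sum_dir (F : dir -> nat) k :
  \sum_i F i = F k + F (ordS k) + F (ord_pred k).
Proof.
rewrite (bigD1 k) // (bigD1 (ordS k)) ?ordS_neq //.
rewrite (bigD1 (ord_pred k)) /=; last first.
  by rewrite ord_pred_neq ord_pred_neqS.
rewrite big1 ?addn0 ?addnA // => i /andP[/andP[]].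
by rewrite neq_dir; case/orP => ->.
Qed.

Definition coord (i : dir) (u : V) : 'I_q :=
  match val i with 0 => u.1.1 | 1 => u.1.2 | _ => u.2 end.

Definition vtx (f : dir -> 'I_q) : V :=
  (f (inord 0), f (inord 1), f (inord 2)).

Lemma coord_vtx f i : coord i (vtx f) = f i.
Proof.
by rewrite -[in RHS](inord_val i); case: i => [[|[|[|]]]].
Qed.

Definition line (i : dir) (u v : V) : bool :=
  [forall j, (j != i) ==> (coord j u == coord j v)].

Lemma lineE i u v :
  line i u v = (coord (ordS i) u == coord (ordS i) v) &&
               (coord (ord_pred i) u == coord (ord_pred i) v).
Proof.
apply/forallP/andP => [H|[H1 H2] j].
  by rewrite !(implyP (H _)) ?ordS_neq ?ord_pred_neq.
by rewrite neq_dir; apply/implyP => /orP[]/eqP->.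
Qed.

Lemma line_refl i u : line i u u.
Proof. by rewrite lineE !eqxx. Qed.

Lemma line_sym i u v : line i u v = line i v u.
Proof. by rewrite !lineE ![coord _ u == _]eq_sym. Qed.

Lemma line_trans i u v w : line i u v -> line i v w -> line i u w.
Proof.
by rewrite !lineE => /andP[/eqP-> /eqP->].
Qed.

Lemma closed_nbhd_line u v :
  (v \in closed_nbhd (@Kq3 q) u) = [exists i, line i u v].
Proof.
have -> : [exists i, line i u v] =
    [|| line (inord 0) u v, line (inord 1) u v | line (inord 2) u v].
  apply/existsP/or3P => [[i]|].
    by rewrite -(inord_val i); case: i => [[|[|[|]]]] //= _;
      [apply: Or31|apply: Or32|apply: Or33].
  by case=> l; eexists; exact: l.
case: u v => [[x y] z] [[x' y'] z'].
rewrite inE /Kq3 !lineE /coord /= !inordK //= !xpair_eqE.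
rewrite ![x' == x]eq_sym ![y' == y]eq_sym ![z' == z]eq_sym.
by case: (x == x'); case: (y == y'); case: (z == z').
Qed.

(** * The codewords on a line *)

Variable C : {set V}.

Definition pipe i u := [set c in C | line i u c].

Lemma mem_pipe i u c : (c \in pipe i u) = (c \in C) && line i u c.
Proof. by rewrite inE. Qed.

Lemma eq_pipe i u v : line i u v -> pipe i u = pipe i v.
Proof.
move=> uv; apply/setP => c; rewrite !mem_pipe; congr (_ && _).
apply/idP/idP => l; last exact: line_trans uv l.
by rewrite line_sym in uv; exact: line_trans uv l.
Qed.

Lemma Iset_pipes u : Iset (@Kq3 q) C u = \bigcup_i pipe i u.
Proof.
apply/setP => c; rewrite inE closed_nbhd_line.
apply/andP/bigcupP => [[/existsP[i l] cC]|[i _]].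
  by exists i; rewrite // mem_pipe cC.
by rewrite mem_pipe => /andP[-> l]; split=> //; apply/existsP; exists i.
Qed.

Definition multi i u := 1 < #|pipe i u|.

(** * Exposed vertices and crossed codewords in a layer *)

Definition layer k a := [set c in C | coord k c == a].

(** Inside a layer, a pipe is a fibre of the coordinate other than its own
    direction. *)
Lemma pipe_ordS k u :
  pipe (ordS k) u = [set c in layer k (coord k u) |
                      coord (ord_pred k) c == coord (ord_pred k) u].
Proof.
apply/setP => c; rewrite !inE lineE ordSS ordSK -andbA; congr (_ && _).
by rewrite andbC; congr (_ && _); rewrite eq_sym.
Qed.

Lemma pipe_ord_pred k u :
  pipe (ord_pred k) u = [set c in layer k (coord k u) |
                      coord (ordS k) c == coord (ordS k) u].
Proof.
apply/setP => c; rewrite !inE lineE ord_predpred ord_predK -andbA.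
congr (_ && _).
by congr (_ && _); rewrite eq_sym.
Qed.

Definition crossed k := [set c in C | multi (ordS k) c && multi (ord_pred k) c].

Definition exposed k :=
  [set u : V | (pipe (ordS k) u == set0) && (pipe (ord_pred k) u == set0)].

(** The values of coordinate [j] absent from the layer index its empty lines:
    those that run in the direction different from [j] and [k]. *)
Definition missed k j a := ~: (coord j @: layer k a).

(** A line with [m >= 2] codewords leaves [m - 1 >= m / 2] more lines empty than
    [m] lines with one codeword each.  Crossed codewords are on such lines in
    both directions, so both numbers of missed values are at least
    [q - #|layer k a|] plus half the number of crossed codewords. *)
Lemma missed_layer_bound k a :
  6 * q + 3 * #|[set c in crossed k | coord k c == a]| <=
  9 + #|missed k (ordS k) a| * #|missed k (ord_pred k) a| + 6 * #|layer k a|.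
Proof.
have bound j i : (forall c, coord k c = a ->
      pipe i c = [set x in layer k a | coord j x == coord j c]) ->
    (forall c, c \in crossed k -> multi i c) ->
    2 * q + #|[set c in crossed k | coord k c == a]| <=
      2 * #|missed k j a| + 2 * #|layer k a|.
  move=> pipeE crossed_multi.
  pose repeated := [set x in layer k a |
    1 < #|[set y in layer k a | coord j y == coord j x]|].
  have : #|repeated| + 2 * #|coord j @: layer k a| <= 2 * #|layer k a|.
    exact: card_repeated_add_imset.
  have : #|missed k j a| + #|coord j @: layer k a| = q.
    by rewrite addnC cardsC card_ord.
  have : #|[set c in crossed k | coord k c == a]| <= #|repeated|.
    apply: subset_leq_card; apply/subsetP => c; rewrite !inE.
    move=> /andP[cX /eqP ca]; have mi : multi i c.
      by apply: crossed_multi; rewrite inE.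
    by rewrite -(pipeE _ ca) -/(multi i c) mi ca eqxx !andbT; case/andP: cX.
  lia.
have boundS : 2 * q + #|[set c in crossed k | coord k c == a]| <=
      2 * #|missed k (ordS k) a| + 2 * #|layer k a|.
  apply: (bound _ (ord_pred k)) => c; first by move=> <-; rewrite pipe_ord_pred.
  by rewrite inE => /and3P[].
have boundP : 2 * q + #|[set c in crossed k | coord k c == a]| <=
      2 * #|missed k (ord_pred k) a| + 2 * #|layer k a|.
  apply: (bound _ (ordS k)) => c; first by move=> <-; rewrite pipe_ordS.
  by rewrite inE => /and3P[].
have := six_minn_le #|missed k (ordS k) a| #|missed k (ord_pred k) a|; lia.
Qed.

Lemma card_by_coord k (A : {set V}) :
  \sum_(a < q) #|[set c in A | coord k c == a]| = #|A|.
Proof.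
rewrite -[RHS]sum1_card (partition_big (coord k) predT) //=.
by apply: eq_bigr => a _; rewrite -sum1_card; apply: eq_bigl => c; rewrite inE.
Qed.

(** An empty line in one direction and an empty line in the other direction of
    a layer meet in an exposed vertex. *)
Lemma missed_le_exposed k :
  \sum_(a < q) #|missed k (ordS k) a| * #|missed k (ord_pred k) a|
    <= #|exposed k|.
Proof.
rewrite -(card_by_coord k (exposed k)); apply: leq_sum => a _.
rewrite -cardsX.
pose g (p : 'I_q * 'I_q) := vtx (fun i => if i == k then a else
  if i == ordS k then p.1 else p.2).
have gk p : coord k (g p) = a by rewrite coord_vtx eqxx.
have gS p : coord (ordS k) (g p) = p.1.
  by rewrite coord_vtx (negPf (ordS_neq k)) eqxx.
have gP p : coord (ord_pred k) (g p) = p.2.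
  by rewrite coord_vtx (negPf (ord_pred_neq k)) (negPf (ord_pred_neqS k)).
have g_inj : injective g.
  move=> p r e.
  by rewrite [p]surjective_pairing [r]surjective_pairing -!gS -!gP e.
rewrite -(card_imset _ g_inj); apply: subset_leq_card.
apply/subsetP => _ /imsetP[p + ->]; rewrite !inE gk eqxx andbT => /andP[m1 m2].
rewrite pipe_ordS pipe_ord_pred gk gS gP.
apply/andP; split; rewrite -subset0; apply/subsetP => c;
  rewrite inE => /andP[cL /eqP e].
  by case/negP: m2; rewrite -e; apply: imset_f.
by case/negP: m1; rewrite -e; apply: imset_f.
Qed.

(** * Exposed vertices in an identifying code *)

Hypothesis idC : identifying_code (@Kq3 q) C.

Lemma Iset_neq0 u : Iset (@Kq3 q) C u != set0.
Proof. by case/and3P: idC => _ /forallP. Qed.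

Lemma Iset_inj : injective (Iset (@Kq3 q) C).
Proof.
move=> u v e; apply/eqP; apply: contraT => uv.
case/and3P: idC => _ _ /forallP/(_ u)/forallP/(_ v)/implyP/(_ uv).
by rewrite e eqxx.
Qed.

Lemma Iset_exposed k u : u \in exposed k -> Iset (@Kq3 q) C u = pipe k u.
Proof.
rewrite inE => /andP[/eqP e1 /eqP e2]; rewrite Iset_pipes (bigD1 k) //=.
rewrite [X in _ :|: X]big1 ?setU0 // => i.
by rewrite neq_dir => /orP[]/eqP->.
Qed.

(** A vertex exposed in two ways would have all its pipes empty, and would not
    be covered by the code. *)
Lemma exposed_disjoint i j : i != j -> [disjoint exposed i & exposed j].
Proof.
move=> ij; rewrite -setI_eq0 -subset0; apply/subsetP => u.
rewrite inE => /andP[ui uj].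
have := Iset_neq0 u; rewrite (Iset_exposed _ _ ui).
move: uj ij; rewrite inE neq_dir => /andP[/eqP s /eqP p].
by move=> /orP[]/eqP ->; rewrite ?s ?p eqxx.
Qed.

Definition mdeg u := \sum_i multi i u.

Definition multi_pipes :=
  [set pipe p.1 p.2 | p : dir * V & multi p.1 p.2].

Definition light := [set c in C | mdeg c == 1].
Definition heavy := [set c in C | 1 < mdeg c].

Lemma multi_pipe i u v : v \in pipe i u -> pipe i v = pipe i u.
Proof. by rewrite mem_pipe => /andP[_]; rewrite line_sym; apply: eq_pipe. Qed.

Lemma pipe_single i c : c \in C -> ~~ multi i c -> pipe i c = [set c].
Proof.
move=> cC m; apply/esym/eqP.
rewrite eqEcard cards1 leqNgt m andbT sub1set mem_pipe cC.
exact: line_refl.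
Qed.

(** The pipes of a light codeword [c] other than its shared one are [[set c]],
    hence contained in the shared one. *)
Lemma Iset_light c : c \in light -> Iset (@Kq3 q) C c \in multi_pipes.
Proof.
rewrite inE => /andP[cC /eqP d1].
have [i mi] : exists i, multi i c.
  apply/existsP; apply: contraT; rewrite negb_exists => /forallP H.
  by move: d1; rewrite /mdeg big1 // => i _; rewrite (negPf (H i)).
have -> : Iset (@Kq3 q) C c = pipe i c; last first.
  by apply/imsetP; exists (i, c); rewrite ?inE.
rewrite Iset_pipes (bigD1 i) //=; apply/setUidPl/bigcupsP => j ji.
rewrite pipe_single // ?sub1set ?mem_pipe ?cC ?line_refl //.
move: d1; rewrite /mdeg (bigD1 i) // (bigD1 j) //= mi; lia.
Qed.

Lemma card_light_le : #|light| <= #|multi_pipes|.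
Proof.
rewrite -(card_imset _ Iset_inj); apply: subset_leq_card.
by apply/subsetP => _ /imsetP[c + ->]; apply: Iset_light.
Qed.

(** Double counting of the incidences between codewords and shared pipes, each
    of which has at least two codewords. *)
Lemma card_multi_pipes_le : 2 * #|multi_pipes| <= \sum_(c in C) mdeg c.
Proof.
rewrite -sum1_card big_distrr /=.
apply: (@leq_trans (\sum_(P in multi_pipes) #|P|)).
  by apply: leq_sum => P /imsetP[[i u]]; rewrite inE muln1 => m ->.
under eq_bigr do rewrite -sum1_card.
rewrite (exchange_big_dep [in C]) /=; last first.
  by move=> P c /imsetP[[i u] _ ->]; rewrite mem_pipe => /andP[].
apply: leq_sum => c cC; rewrite /mdeg -[X in _ <= X]big_mkcond /= !sum1dep_card.
apply: leq_trans (leq_imset_card (fun i => pipe i c) _).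
apply: subset_leq_card.
apply/subsetP => P; rewrite inE => /andP[/imsetP[[i u]]].
rewrite inE /= => m -> cP; rewrite -(multi_pipe _ _ _ cP); apply: imset_f.
by rewrite inE /multi (multi_pipe _ _ _ cP).
Qed.

Definition all_exposed := \bigcup_k exposed k.

Lemma exposed_light_disjoint : [disjoint all_exposed & light].
Proof.
rewrite -setI_eq0 -subset0; apply/subsetP => u.
rewrite inE => /andP[/bigcupP[k _]].
rewrite !inE => /andP[/eqP/setP/(_ u) + _] /andP[uC _].
by rewrite mem_pipe uC line_refl inE.
Qed.

(** If the only nonempty pipe of [u] is [[set c]] and [c] shares no line, then
    [Iset c] is [[set c]] too, so that [u = c]; but then no pipe of [u] is
    empty. *)
Lemma Iset_exposed_cases u : u \in all_exposed ->
  Iset (@Kq3 q) C u \in multi_pipes :|: [set [set c] | c in light :|: heavy].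
Proof.
move=> uE; have := uE; case/bigcupP => k _ uk.
have IP := Iset_exposed _ _ uk.
have /set0Pn[c cI] := Iset_neq0 u; rewrite IP in cI.
rewrite inE; case m: (multi k u).
  by apply/orP; left; rewrite IP; apply/imsetP; exists (k, u); rewrite ?inE.
have P1 : pipe k u = [set c].
  by apply/esym/eqP; rewrite eqEcard cards1 sub1set cI leqNgt -/(multi k u) m.
apply/orP; right; rewrite IP P1; apply: imset_f.
have cC : c \in C by move: cI; rewrite mem_pipe => /andP[].
rewrite !inE cC /=; case d: (mdeg c) => [|[|n]] //.
have Ic : Iset (@Kq3 q) C c = [set c].
  rewrite Iset_pipes; apply/eqP; rewrite eqEsubset; apply/andP; split.
    apply/bigcupsP => i _; rewrite pipe_single //.
    by move: d; rewrite /mdeg (bigD1 i) //=; case: (multi i c).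
  by apply/subsetP => x /set1P->; apply/bigcupP; exists k => //;
    rewrite mem_pipe cC line_refl.
have uc : u = c by apply: Iset_inj; rewrite IP P1 Ic.
move: uk; rewrite inE uc => /andP[/eqP/setP/(_ c) + _].
by rewrite mem_pipe cC line_refl inE.
Qed.

(** Injectivity of [Iset] on exposed vertices and light codewords together: the
    light codewords add as many possible singletons as they use up values of
    [Iset], so they drop out of the bound. *)
Lemma card_all_exposed_le : #|all_exposed| <= #|multi_pipes| + #|heavy|.
Proof.
rewrite -(leq_add2r #|light|).
have /eqP <- : #|all_exposed :|: light| == #|all_exposed| + #|light|.
  by rewrite leq_card_setU exposed_light_disjoint.
rewrite -(card_imset _ Iset_inj).
apply: (@leq_trans #|multi_pipes :|: [set [set c] | c in light :|: heavy]|).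
  apply: subset_leq_card; apply/subsetP => _ /imsetP[u + ->].
  rewrite inE => /orP[].
    exact: Iset_exposed_cases.
  by move=> /Iset_light; rewrite [in X in _ -> X]inE => ->.
apply: leq_trans (leq_card_setU _ _) _; rewrite -addnA leq_add2l addnC.
exact: leq_trans (leq_imset_card _ _) (leq_card_setU _ _).
Qed.

(** Eliminating the number of shared pipes from the three preceding bounds
    leaves [mdeg c + 1] for each heavy codeword [c], where [mdeg c] is [2] or
    [3]; such a codeword is crossed in [1], respectively [3], layers. *)
Lemma all_exposed_le_crossed :
  #|all_exposed| <= 3 * \sum_k #|crossed k|.
Proof.
have sumC : \sum_k #|crossed k| =
    \sum_(c in C) \sum_k (multi (ordS k) c && multi (ord_pred k) c).
  rewrite exchange_big; apply: eq_bigr => k _.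
  rewrite -sum1_card big_mkcond [RHS]big_mkcond.
  by apply: eq_bigr => c _; rewrite inE; case: (c \in C).
have lightE : #|light| = \sum_(c in C) (mdeg c == 1).
  rewrite -sum1_card big_mkcond [RHS]big_mkcond.
  by apply: eq_bigr => c _; rewrite inE; case: (c \in C).
have heavyE : #|heavy| = \sum_(c in C) (1 < mdeg c).
  rewrite -sum1_card big_mkcond [RHS]big_mkcond.
  by apply: eq_bigr => c _; rewrite inE; case: (c \in C).
(* This suffices because [#|all_exposed| <= #|multi_pipes| + #|heavy|] and
   [#|multi_pipes| <= 2 * #|multi_pipes| - #|light|]. *)
suff : \sum_(c in C) mdeg c + #|heavy| <= #|light| + 3 * \sum_k #|crossed k|.
  have := card_all_exposed_le; have := card_light_le.
  have := card_multi_pipes_le; lia.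
rewrite sumC lightE heavyE big_distrr -!big_split /=; apply: leq_sum => c _.
(* What remains is an inequality in the three booleans [multi i c]. *)
rewrite /mdeg !(sum_dir _ ord0) !ordSK !ord_predK !ordSS !ord_predpred.
by case: (multi _ c); case: (multi _ c); case: (multi _ c).
Qed.

(** * The lower bound *)

Lemma identifying_Kq3_bound : 2 * q ^ 2 <= 3 * q + 2 * #|C|.
Proof.
have E : \sum_k #|exposed k| = #|all_exposed|.
  rewrite -sum1_card (partition_disjoint_bigcup _ _ exposed_disjoint).
  by apply: eq_bigr => k _; rewrite sum1_card.
have sum_const m n : \sum_(a < m) n = n * m.
  by rewrite sum_nat_const card_ord mulnC.
have B k : 6 * q ^ 2 + 3 * #|crossed k| <= 9 * q + #|exposed k| + 6 * #|C|.
  apply: (@leq_trans (9 * q + \sum_(a < q) #|missed k (ordS k) a| *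
    #|missed k (ord_pred k) a| + 6 * #|C|)); last first.
    by rewrite leq_add2r leq_add2l missed_le_exposed.
  rewrite -(card_by_coord k C) -(card_by_coord k (crossed k)) -mulnn mulnA.
  rewrite -(sum_const q (6 * q)) -(sum_const q 9) !big_distrr -!big_split /=.
  by apply: leq_sum => a _; apply: missed_layer_bound.
have : 18 * q ^ 2 + 3 * \sum_k #|crossed k| <=
       27 * q + \sum_k #|exposed k| + 18 * #|C|.
  have := B ord0; have := B (ordS ord0); have := B (ord_pred ord0).
  rewrite !(sum_dir _ ord0); lia.
rewrite E; have := all_exposed_le_crossed; lia.
Qed.

End Code.

Theorem theorem34 (q : nat) (hq : (1 <= q)%N) :
  q%:R ^+ 2 - 3%:R / 2%:R * q%:R <= (gammaID (@Kq3 q))%:R :> rat.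
Proof.
have [[C idC <-] _] := gammaIDP (Kq3_identifiable hq).
have := identifying_Kq3_bound _ _ idC.
rewrite -(ler_nat rat) !natrD !natrM; lra.
Qed.
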